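(* Let $S = \mathbb{N}$ or $S = \mathbb{Z}$, and let $\mathfrak{X} = (X_i)_{i \in S}$ be a negatively associated, weakly stationary, $\{0,1\}$-valued process. Then the tail $\sigma$-field $\mathcal{T}(\mathfrak{X})$ is trivial: $\mathbb{P}(E) \in \{0,1\}$ for every $E \in \mathcal{T}(\mathfrak{X})$.
   Context: A stochastic process $(X_i)_{i \in S}$ is negatively associated if $\mathbb{E}[fg] \leq \mathbb{E}[f]\,\mathbb{E}[g]$ for every pair of coordinatewise increasing (i.e. nondecreasing) functions $f$ and $g$ of the process that depend on disjoint subsets of the components (and for which these expectations exist). It is weakly stationary if for every $k \in S$ one has $\mathbb{E}[X_i] = \mathbb{E}[X_{i+k}]$ for all $i \in S$ and $\mathrm{cov}(X_i,X_j) = \mathrm{cov}(X_{i+k},X_{j+k})$ for all $i,j \in S$. The tail $\sigma$-field is $\mathcal{T}(\mathfrak{X}) = \bigcap_{\Lambda} \sigma(X_i : i \in S \setminus \Lambda)$, the intersection being over all finite $\Lambda \subset S$; for $S=\mathbb{N}$ this equals $\bigcap_{n=1}^\infty \sigma(X_i : i \geq n)$. *)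

(* Defs.v *)
From HB Require Import structures.
From mathcomp Require Import all_boot all_order all_algebra.
From mathcomp Require Import all_classical all_reals all_analysis.
Set Implicit Arguments.
Unset Strict Implicit.
Unset Printing Implicit Defensive.
Import Order.TTheory GRing.Theory Num.Theory.
Local Open Scope classical_set_scope.
Local Open Scope ring_scope.

(* sigma(Y i : i in A) *)
Definition sigma_family (S Om : Type) (R : realType) (Y : S -> Om -> R)
    (A : set S) : set (set Om) :=
  <<s \bigcup_(i in A) preimage_set_system setT (Y i) measurable >>.

(* measurability for the product sigma-field on S -> R, which is the one
   generated by the coordinate maps *)
Definition product_measurable (S : Type) (R : realType) (f : (S -> R) -> R) :=
  forall B : set R, measurable B ->
    sigma_family (fun (i : S) (x : S -> R) => x i) setT (f @^-1` B).

Definition coordinatewise_nondecreasing (S : Type) (R : realType)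
    (f : (S -> R) -> R) :=
  forall x y : S -> R, (forall i, x i <= y i) -> f x <= f y.

Definition depends_only_on (S : Type) (R : realType) (A : set S)
    (f : (S -> R) -> R) :=
  forall x y : S -> R, (forall i, A i -> x i = y i) -> f x = f y.

Section processes.
Context d (Om : measurableType d) (R : realType) (P : probability Om R).

Definition zero_one_valued (S : Type) (X : S -> {RV P >-> R}) :=
  forall i w, X i w = 0 \/ X i w = 1.

(* f(X) *)
Definition of_process (S : Type) (X : S -> {RV P >-> R}) (f : (S -> R) -> R) :
  Om -> R := fun w => f (fun i => X i w).

(* A and B may be infinite; "the expectations exist" is read as integrability
   of f(X), g(X) and f(X)g(X) *)
Definition negatively_associated (S : Type) (X : S -> {RV P >-> R}) :=
  forall (A B : set S) (f g : (S -> R) -> R),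
    A `&` B = set0 ->
    product_measurable f -> product_measurable g ->
    coordinatewise_nondecreasing f -> coordinatewise_nondecreasing g ->
    depends_only_on A f -> depends_only_on B g ->
    of_process X f \in Lfun P 1 ->
    of_process X g \in Lfun P 1 ->
    of_process X f * of_process X g \in Lfun P 1 ->
    ('E_P[of_process X f * of_process X g]
       <= 'E_P[of_process X f] * 'E_P[of_process X g])%E.

(* The library's expectation and covariance are total; for the bounded
   processes considered here they are always the genuine finite moments. *)
Definition weakly_stationary (S : nmodType) (X : S -> {RV P >-> R}) :=
  forall k : S,
    (forall i, 'E_P[X i] = 'E_P[X (i + k)%R])%E /\
    (forall i j, covariance P (X i) (X j)
               = covariance P (X (i + k)) (X (j + k))).

Definition tail_sigma_field (S : Type) (X : S -> {RV P >-> R}) : set (set Om) :=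
  \bigcap_(L in [set L : set S | finite_set L]) sigma_family X (~` L).

End processes.

(* Main.v *)
(* Write N_s for the sum of the X_i, i in s.  If f, g take values in [0, 1]
   and depend on disjoint finite sets s, t of coordinates, then N_s +- f and
   N_t +- g are nondecreasing, because a flip of some coordinate changes N by at
   least 1 and f by at most 1.  Negative association applied to the four pairs
   gives the Newman-type bound
     |cov(f, g)| <= - cov(N_s, N_t) <= sum_(i in s, j in t) |cov(X_i, X_j)|.
   Off-diagonal covariances are nonpositive, so stationarity and nonnegativity
   of the variance of X_0 + ... + X_(n-1) make j |-> |cov(X_i, X_j)| summable.
   Hence the right-hand side vanishes as t moves off to infinity, uniformly in
   g; by the monotone class theorem a tail event is independent of every
   cylinder event, and then of itself. *)

Require Import Defs.
From HB Require Import structures.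
From mathcomp Require Import all_boot all_order all_algebra.
From mathcomp Require Import all_classical all_reals all_analysis.
From mathcomp Require Import measurable_realfun.
From mathcomp Require Import ring lra zify.
Set Implicit Arguments.
Unset Strict Implicit.
Unset Printing Implicit Defensive.
Import Order.TTheory GRing.Theory Num.Theory numFieldNormedType.Exports.
Local Open Scope classical_set_scope.
Local Open Scope ring_scope.

(** * Events determined by finitely many binary coordinates *)

Section determined.
Context (S : eqType) (T : Type).
Implicit Types (Y : S -> T -> bool) (s : seq S) (A : set T).

Definition agree Y s (x y : T) := forall i, i \in s -> Y i x = Y i y.

Definition determined Y s A := forall x y, agree Y s x y -> A x -> A y.

Lemma agree_sym Y s x y : agree Y s x y -> agree Y s y x.
Proof. by move=> h i /h. Qed.

Lemma sub_agree Y s t x y : {subset s <= t} -> agree Y t x y -> agree Y s x y.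
Proof. by move=> st h i /st /h. Qed.

Lemma determined_setC Y s A : determined Y s A -> determined Y s (~` A).
Proof. by move=> dA x y /agree_sym h nAx /(dA _ _ h). Qed.

Lemma sub_determined Y s t A : {subset s <= t} ->
  determined Y s A -> determined Y t A.
Proof. by move=> st dA x y /(sub_agree st); exact: dA. Qed.

Lemma determined_setI Y s A B :
  determined Y s A -> determined Y s B -> determined Y s (A `&` B).
Proof. by move=> dA dB x y h [/(dA _ _ h) ? /(dB _ _ h)]. Qed.

(** Finitely many bits cut [T] into finitely many pieces, and [A] is a union of some of them. The
    sigma-algebra [M] is arbitrary because the lemma serves both on [Om] and on the configuration
    space [S -> R]. *)
Lemma determined_sigma_algebra (M : set (set T)) Y s A :
  sigma_algebra setT M -> (forall i, i \in s -> M [set x | Y i x]) ->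
  determined Y s A -> M A.
Proof.
case=> M0 MC MU.
have {}MC B : M B -> M (~` B) by move=> /MC; rewrite setTD.
have M2 B C : M B -> M C -> M (B `|` C).
  move=> MB MC'; rewrite -bigcup2E; apply: MU => -[|[|n]] //=.
have MI B C : M B -> M C -> M (B `&` C).
  by move=> ? ?; rewrite -[_ `&` _]setCK setCI; apply/MC/M2; exact: MC.
elim: s A => [|i s IH] A Ms dA.
  (* With no coordinates any two points agree, so [A] is empty or everything. *)
  have [->|/set0P[x Ax]] := eqVneq A set0; first exact: M0.
  suff -> : A = ~` set0 by exact: MC.
  by apply/seteqP; split => y _; [case|exact: (dA x)].
(* The part of [A] where bit [i] equals [b], saturated under agreement on [s]: this forgets bit [i],
   so the induction hypothesis applies. *)
pose slice b := [set x | exists y, [/\ A y, Y i y = b & agree Y s y x]].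
have Mslice b : M (slice b).
  apply: IH => [j js|x x' h [y [Ay Yy yx]]].
    by apply: Ms; rewrite inE js orbT.
  by exists y; split => // j js; rewrite yx// h.
have MY : M [set x | Y i x] by apply: Ms; rewrite inE eqxx.
suff -> : A = ([set x | Y i x] `&` slice true) `|`
              (~` [set x | Y i x] `&` slice false).
  by apply: M2; apply: MI => //; exact: MC.
apply/seteqP; split => x.
  by move=> Ax; case: (boolP (Y i x)) => Yx; [left|right]; split => //;
    [|exact/negP|]; exists x; split => //; exact/negbTE.
have key b : Y i x = b -> slice b x -> A x.
  move=> Yx [y [Ay Yy yx]]; apply: dA Ay => j; rewrite inE.
  by case/orP => [/eqP ->|/yx //]; rewrite Yx Yy.
by case=> -[/= Yx]; apply: key => //; exact/negP.
Qed.

End determined.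

(** If the sum over [L] is within [e] of the supremum of all finite sums, a finite set disjoint from
    [L] can add at most [e]. *)
Lemma summable_tail (S : eqType) (R : realType) (a : S -> R) (M : R) :
  (forall j, 0 <= a j) ->
  (forall t, uniq t -> \sum_(j <- t) a j <= M) ->
  forall e, 0 < e -> exists L : seq S, forall t, uniq t ->
    (forall j, j \in t -> j \notin L) -> \sum_(j <- t) a j <= e.
Proof.
move=> a0 aM e e0.
pose B := [set x : R | exists2 t, uniq t & x = \sum_(j <- t) a j].
have B_sup : has_sup B.
  split; first by exists 0, [::]; rewrite ?big_nil.
  by exists M => _ [t ut ->]; exact: aM.
have [x [L uL xE] Lx] := sup_adherent e0 B_sup.
exists L => t ut tL.
have : \sum_(j <- L ++ t) a j <= sup B.
  apply: ub_le_sup; first by case: B_sup.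
  exists (L ++ t) => //; rewrite cat_uniq uL ut/= andbT.
  by apply/hasPn => j /tL.
by rewrite big_cat/= -xE => ?; lra.
Qed.

(** * Real-valued expectation and covariance of bounded measurable functions *)

Section real_expectation.
Context d (Om : measurableType d) (R : realType) (P : probability Om R).
Implicit Types f g h : Om -> R.

(** This class is closed under sums, negation and products and consists of integrable functions, so
    moments can be computed in [R] rather than in the extended reals. *)
Definition bdd_measurable f :=
  measurable_fun setT f /\ exists M, forall x, `|f x| <= M.

Definition Ex f : R := fine 'E_P[f].

Definition cov f g : R := Ex (f * g) - Ex f * Ex g.

Lemma bdd_measurable_cst c : bdd_measurable (cst c).
Proof. by split => //; exists `|c|. Qed.

Lemma bdd_measurableD f g :
  bdd_measurable f -> bdd_measurable g -> bdd_measurable (f + g).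
Proof.
move=> [mf [M fM]] [mg [N gN]]; split; first exact: measurable_funD.
by exists (M + N) => x; rewrite (le_trans (ler_normD _ _))// lerD.
Qed.

Lemma bdd_measurableN f : bdd_measurable f -> bdd_measurable (- f).
Proof.
move=> [mf [M fM]]; split; first exact: measurableT_comp.
by exists M => x; rewrite normrN.
Qed.

Lemma bdd_measurableM f g :
  bdd_measurable f -> bdd_measurable g -> bdd_measurable (f * g).
Proof.
move=> [mf [M fM]] [mg [N gN]]; split; first exact: measurable_funM.
by exists (M * N) => x; rewrite normrM ler_pM.
Qed.

Lemma bdd_measurable_sum (I : Type) (s : seq I) (F : I -> Om -> R) :
  (forall i, bdd_measurable (F i)) -> bdd_measurable (\sum_(i <- s) F i).
Proof.
move=> hF; elim/big_ind : _ => //; first exact: (bdd_measurable_cst 0).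
exact: bdd_measurableD.
Qed.

Lemma bdd_measurable_indic (A : set Om) :
  measurable A -> bdd_measurable (\1_A : Om -> R).
Proof.
move=> mA; split; first exact: measurable_indic.
by exists 1 => x; rewrite indicE normr_nat lern1 leq_b1.
Qed.

Lemma bdd_measurable_Lfun1 f : bdd_measurable f -> f \in Lfun P 1.
Proof.
move=> [mf [M fM]]; apply/Lfun1_integrable.
apply: measurable_bounded_integrable => //.
  by rewrite (le_lt_trans (probability_le1 _ _))// ltry.
by exists M; split; [exact: num_real|move=> y My x _; exact: le_trans (fM x) (ltW My)].
Qed.

Lemma ExE f : bdd_measurable f -> (Ex f)%:E = 'E_P[f]%E.
Proof. by move=> ?; rewrite fineK// expectation_fin_num// bdd_measurable_Lfun1. Qed.

Lemma ExD f g : bdd_measurable f -> bdd_measurable g ->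
  Ex (f + g) = Ex f + Ex g.
Proof.
move=> bf bg; apply: EFin_inj; rewrite EFinD !ExE//; last exact: bdd_measurableD.
by rewrite expectationD// bdd_measurable_Lfun1.
Qed.

Lemma Ex0 : Ex 0 = 0.
Proof. by rewrite /Ex -[0]/(cst 0) expectation_cst. Qed.

Lemma ExN f : bdd_measurable f -> Ex (- f) = - Ex f.
Proof.
move=> bf; have := ExD bf (bdd_measurableN bf).
by rewrite subrr Ex0 => ?; lra.
Qed.

Lemma Ex_indic (A : set Om) : measurable A -> Ex \1_A = fine (P A).
Proof. by move=> mA; rewrite /Ex expectation_indic. Qed.

Lemma Ex_ge0 f : (forall x, 0 <= f x) -> 0 <= Ex f.
Proof. by move=> f0; rewrite fine_ge0// expectation_ge0. Qed.

Lemma covC f g : cov f g = cov g f.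
Proof. by rewrite /cov mulrC [Ex f * _]mulrC. Qed.

Lemma covDl f g h : bdd_measurable f -> bdd_measurable g -> bdd_measurable h ->
  cov (f + g) h = cov f h + cov g h.
Proof.
move=> bf bg bh; rewrite /cov mulrDl !ExD//; try exact: bdd_measurableM.
by ring.
Qed.

Lemma covNl f g : bdd_measurable f -> bdd_measurable g ->
  cov (- f) g = - cov f g.
Proof.
move=> bf bg; rewrite /cov mulNr !ExN//; first by ring.
exact: bdd_measurableM.
Qed.

Lemma covDr f g h : bdd_measurable f -> bdd_measurable g -> bdd_measurable h ->
  cov h (f + g) = cov h f + cov h g.
Proof. by move=> *; rewrite covC covDl// !(covC h). Qed.

Lemma covNr f g : bdd_measurable f -> bdd_measurable g ->
  cov g (- f) = - cov g f.
Proof. by move=> *; rewrite covC covNl// covC. Qed.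

Lemma cov_suml (I : Type) (s : seq I) (F : I -> Om -> R) g :
  (forall i, bdd_measurable (F i)) -> bdd_measurable g ->
  cov (\sum_(i <- s) F i) g = \sum_(i <- s) cov (F i) g.
Proof.
move=> hF hg; elim: s => [|i s IH].
  by rewrite !big_nil /cov mul0r Ex0 mul0r subrr.
by rewrite !big_cons covDl// ?IH//; exact: bdd_measurable_sum.
Qed.

Lemma cov_sumr (I : Type) (s : seq I) (F : I -> Om -> R) g :
  (forall i, bdd_measurable (F i)) -> bdd_measurable g ->
  cov g (\sum_(i <- s) F i) = \sum_(i <- s) cov g (F i).
Proof. by move=> *; rewrite covC cov_suml//; under eq_bigr do rewrite covC. Qed.

(** Constants have zero covariance with everything, so [f] may be centred at its mean; what remains
    is the expectation of a square. *)
Lemma cov_ge0 f : bdd_measurable f -> 0 <= cov f f.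
Proof.
move=> bf; pose c : Om -> R := cst (Ex f).
have bc : bdd_measurable c by exact: bdd_measurable_cst.
have Ec : Ex c = Ex f by rewrite /Ex /c expectation_cst.
have covc h : bdd_measurable h -> cov c h = 0.
  move=> bh; rewrite /cov.
  have -> : Ex (c * h) = Ex f * Ex h.
    apply: EFin_inj; rewrite EFinM ExE; last exact: bdd_measurableM.
    rewrite (_ : c * h = Ex f \o* h).
      by rewrite expectationZl ?bdd_measurable_Lfun1// (ExE bh).
    by apply/funext => x /=; rewrite mulrC.
  by rewrite Ec subrr.
have bNc := bdd_measurableN bc.
have bfc : bdd_measurable (f - c) by exact: bdd_measurableD.
have -> : cov f f = cov (f - c) (f - c).
  by rewrite covDl// covNl// covc// covDr// covNr// (covC f c) covc// !subr0.
have Efc : Ex (f - c) = 0 by rewrite ExD// ExN// Ec subrr.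
rewrite /cov Efc mul0r subr0.
by apply: Ex_ge0 => x; exact: sqr_ge0.
Qed.

Lemma fine_covariance f g : bdd_measurable f -> bdd_measurable g ->
  fine (covariance P f g) = cov f g.
Proof.
move=> bf bg; have bfg := bdd_measurableM bf bg.
rewrite covarianceE ?bdd_measurable_Lfun1//.
by rewrite -!ExE// -EFinM -EFinB.
Qed.

Lemma cov_indic (A B : set Om) : measurable A -> measurable B ->
  cov \1_A \1_B = fine (P (A `&` B)) - fine (P A) * fine (P B).
Proof.
move=> mA mB; rewrite /cov -[_ * _]indicI !Ex_indic//; exact: measurableI.
Qed.

End real_expectation.

Lemma sigma_family_sigma_algebra (S Om : Type) (R : realType)
  (Y : S -> Om -> R) (A : set S) : sigma_algebra setT (sigma_family Y A).
Proof. exact: smallest_sigma_algebra. Qed.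

Lemma sigma_family_preimage (S Om : Type) (R : realType)
    (Y : S -> Om -> R) (A : set S) i (B : set R) :
  A i -> measurable B -> sigma_family Y A (Y i @^-1` B).
Proof.
move=> Ai mB; apply: sub_sigma_algebra; exists i => //; exists B => //.
by rewrite setTI.
Qed.

(** * Thresholded configurations and their occupation numbers *)

Section threshold.
Context (R : realType) (S : eqType).
Implicit Types (s : seq S) (x y : S -> R).

(* Thresholding extends monotone functions on {0,1}^S to monotone functions on
   R^S, as the definition of negative association requires. *)
Definition occupied i x : bool := 2^-1 <= x i.

Definition occupation s x : R := \sum_(i <- s) (occupied i x)%:R.

Lemma measurable_occupied : measurable [set r : R | 2^-1 <= r].
Proof.
rewrite (_ : [set r : R | _] = `[2^-1, +oo[%classic) ?measurable_itv//.
by apply/seteqP; split => r /=; rewrite in_itv/= andbT.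
Qed.

Lemma occupation_ext s x y : agree occupied s x y -> occupation s x = occupation s y.
Proof. by move=> h; apply: eq_big_seq => i /h ->. Qed.

Lemma occupation_bound s x : `|occupation s x| <= (size s)%:R.
Proof.
rewrite /occupation; elim: s => [|i s IH]; first by rewrite big_nil normr0.
rewrite big_cons/= (le_trans (ler_normD _ _))// -natr1 addrC lerD//.
by rewrite normr_nat lern1 leq_b1.
Qed.

Lemma le_occupied x y : (forall i, x i <= y i) -> forall i, occupied i x ==> occupied i y.
Proof.
move=> xy i; apply/implyP => h; exact: le_trans h (xy i).
Qed.

(* When [x] and [y] are ordered, either they agree on [s] and [f] does not
   change, or [occupation] grows by at least 1, the oscillation of [f]. *)
Lemma le_occupationD s (f : (S -> R) -> R) x y :
  (forall x, 0 <= f x <= 1) ->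
  (forall x y, agree occupied s x y -> f x = f y) ->
  (forall i, x i <= y i) ->
  occupation s x + `|f x - f y| <= occupation s y.
Proof.
move=> f01 fs xy; have xyon := le_occupied xy.
have [/allP h|/allPn[i is_ ni]] := boolP (all (fun i => occupied i x == occupied i y) s).
  have {}h : agree occupied s x y by move=> i /h /eqP.
  by rewrite (fs _ _ h) subrr normr0 addr0 (occupation_ext h).
have fxy : `|f x - f y| <= 1.
  rewrite ler_norml; have := f01 x; have := f01 y; lra.
apply: le_trans (lerD (lexx _) fxy) _.
rewrite /occupation (perm_big _ (perm_to_rem is_)) [leRHS](perm_big _ (perm_to_rem is_)).
rewrite !big_cons.
(* As [x] lies below [y], disagreement at [i] can only mean empty in [x] and occupied in [y]. *)
have -> : occupied i x = false by move: (xyon i) ni; case: occupied; case: occupied.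
have -> : occupied i y = true by move: (xyon i) ni; case: occupied; case: occupied.
rewrite mulr0n mulr1n /= add0r [leLHS]addrC lerD2l; apply: ler_sum => j _.
by rewrite ler_nat; move: (xyon j); case: occupied; case: occupied.
Qed.

Lemma product_measurable_occupied s (f : (S -> R) -> R) :
  (forall x y, agree occupied s x y -> f x = f y) -> product_measurable f.
Proof.
move=> fs B mB; apply: (@determined_sigma_algebra _ _ _ occupied s).
- exact: sigma_family_sigma_algebra.
- by move=> i _; exact: (sigma_family_preimage _ measurable_occupied).
- by move=> x y /fs h /=; rewrite h.
Qed.

End threshold.

(** * The covariance bound from negative association *)

Section process.
Context d (Om : measurableType d) (R : realType) (P : probability Om R).
Context (S : choiceType) (X : S -> {RV P >-> R}).
Hypothesis X01 : zero_one_valued X.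

Definition state i w : bool := occupied i (fun j => X j w).

Lemma state_nat i w : (state i w)%:R = X i w.
Proof.
rewrite /state /occupied; case: (X01 i w) => ->; last by rewrite invf_le1 ?ler1n.
by rewrite leNgt invr_gt0 ltr0n.
Qed.

Lemma bdd_measurable_X i : bdd_measurable (X i).
Proof.
split; first exact: measurable_funPT.
by exists 1 => w; rewrite -state_nat normr_nat lern1 leq_b1.
Qed.

Lemma of_process_occupation s :
  of_process X (occupation s) = \sum_(i <- s) (X i : Om -> R).
Proof.
apply/funext => w; rewrite /of_process /occupation fct_sumE.
by apply: eq_bigr => i _; exact: state_nat.
Qed.

Lemma measurable_determined s A : determined state s A -> measurable A.
Proof.
apply: (determined_sigma_algebra (M := measurable)); first exact: sigma_algebra_measurable.
move=> i _; rewrite -[X in measurable X]setTI.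
exact: (measurable_funPT (X i) measurableT _ (@measurable_occupied R)).
Qed.

Lemma bdd_measurable_of_process s (f : (S -> R) -> R) M :
  (forall x y, agree (@occupied R S) s x y -> f x = f y) -> (forall x, `|f x| <= M) ->
  bdd_measurable (of_process X f).
Proof.
move=> fs fM; split; last by exists M => w; exact: fM.
move=> _ B mB; rewrite setTI; apply: (@measurable_determined s) => w w' h /=.
by rewrite /of_process (fs _ (fun i => X i w')).
Qed.

(** Negative association concerns functions on [S -> R], so events of [Om] are transported there.
    Saturating under agreement on [s] makes the lift depend on [s] alone, whatever [A] is;
    [of_process_lift] recovers [A] when [s] determines it. *)
Definition event_lift s (A : set Om) : set (S -> R) :=
  [set x | exists w, A w /\ agree (@occupied R S) s (fun i => X i w) x].

Lemma of_process_lift s A : determined state s A ->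
  of_process X \1_(event_lift s A) = \1_A.
Proof.
move=> dA; apply/funext => w; rewrite /of_process !indicE; congr (_%:R).
congr (nat_of_bool _); apply/idP/idP => /set_mem h; apply/mem_set.
  by have [w' [Aw' ww']] := h; apply: dA Aw'.
by exists w.
Qed.

Lemma lift_ext s A x y : agree (@occupied R S) s x y ->
  \1_(event_lift s A) x = \1_(event_lift s A) y :> R.
Proof.
move=> xy; rewrite !indicE; congr (nat_of_bool _)%:R.
apply/idP/idP => /set_mem [w [Aw h]]; apply/mem_set; exists w; split => // i is_.
  by rewrite h// xy.
by rewrite h// xy.
Qed.

Lemma indic01 (T : Type) (A : set T) x : 0 <= (\1_A x : R) <= 1.
Proof. by rewrite indicE ler0n lern1 leq_b1. Qed.

Hypothesis NA : negatively_associated X.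

(** Dependence on finitely many thresholds yields measurability, and boundedness then yields
    integrability, so negative association applies to such functions on disjoint [s] and [t]. *)
Definition admissible s (f : (S -> R) -> R) :=
  [/\ forall x y, agree (@occupied R S) s x y -> f x = f y,
      exists M, forall x, `|f x| <= M & coordinatewise_nondecreasing f].

Lemma cov_admissible_le0 s t f g :
  (forall i, i \in s -> i \notin t) -> admissible s f -> admissible t g ->
  cov P (of_process X f) (of_process X g) <= 0.
Proof.
move=> st [fs [M fM] ndf] [gs [N gN] ndg].
have bf := bdd_measurable_of_process fs fM.
have bg := bdd_measurable_of_process gs gN.
have bfg := bdd_measurableM bf bg.
rewrite /cov subr_le0 -lee_fin EFinM !ExE//.
apply: (NA (A := [set` s]) (B := [set` t])) => //.
- by apply/seteqP; split => // i [/= /st /negP].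
- exact: product_measurable_occupied fs.
- exact: product_measurable_occupied gs.
- move=> x y xy; apply: fs => i is_; rewrite /occupied xy//.
- move=> x y xy; apply: gs => i is_; rewrite /occupied xy//.
- exact: bdd_measurable_Lfun1.
- exact: bdd_measurable_Lfun1.
- exact: bdd_measurable_Lfun1.
Qed.

Lemma admissible_occupation s : admissible s (occupation s).
Proof.
split; [exact: occupation_ext| by exists (size s)%:R; exact: occupation_bound |].
move=> x y xy; apply: ler_sum => i _; rewrite ler_nat.
by move: (le_occupied xy i); case: occupied; case: occupied.
Qed.

(** By [le_occupationD] the growth of [occupation s] absorbs any decrease of the signed
    indicator. *)
Lemma admissible_occupationD s A (e : R) : `|e| = 1 ->
  admissible s (fun x => occupation s x + e * \1_(event_lift s A) x).
Proof.
move=> e1; have ext := @lift_ext s A.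
split.
- by move=> x y xy; rewrite (ext _ _ xy) (occupation_ext xy).
- exists ((size s)%:R + 1) => x; rewrite (le_trans (ler_normD _ _))// lerD//.
    exact: occupation_bound.
  by rewrite normrM e1 mul1r indicE normr_nat lern1 leq_b1.
- move=> x y xy /=; have := le_occupationD (@indic01 _ _) ext xy.
  set u := \1_(event_lift s A) x; set v := \1_(event_lift s A) y.
  have : e * (u - v) <= `|u - v|.
    by rewrite (le_trans (ler_norm _))// normrM e1 mul1r.
  by rewrite mulrBr; lra.
Qed.

Lemma determined_cov_le s t A B :
  (forall i, i \in s -> i \notin t) -> determined state s A -> determined state t B ->
  `|fine (P (A `&` B)) - fine (P A) * fine (P B)| <=
  \sum_(j <- t) \sum_(i <- s) `|cov P (X i) (X j)|.
Proof.
move=> st dA dB.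
have mA := measurable_determined dA; have mB := measurable_determined dB.
pose F : Om -> R := \sum_(i <- s) (X i : Om -> R).
pose G : Om -> R := \sum_(i <- t) (X i : Om -> R).
have bF : bdd_measurable F by apply: bdd_measurable_sum => i; exact: bdd_measurable_X.
have bG : bdd_measurable G by apply: bdd_measurable_sum => i; exact: bdd_measurable_X.
have bA := bdd_measurable_indic R mA; have bB := bdd_measurable_indic R mB.
have bNA := bdd_measurableN bA; have bNB := bdd_measurableN bB.
have key e e' : `|e| = 1 -> `|e'| = 1 ->
    cov P (F + e \*o \1_A) (G + e' \*o \1_B) <= 0.
  move=> he he'.
  have := cov_admissible_le0 st (admissible_occupationD s A he)
    (admissible_occupationD t B he').
  rewrite -(of_process_lift dA) -(of_process_lift dB).
  by rewrite -/F -/G /F /G -!of_process_occupation.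
have e1 (h : Om -> R) : (1 \*o h : Om -> R) = h by apply/funext => x /=; rewrite mul1r.
have eN1 (h : Om -> R) : (-1 \*o h : Om -> R) = - h by apply/funext => x /=; rewrite mulN1r.
have n1 : `|1| = 1 :> R by rewrite normr1.
have nN1 : `|-1| = 1 :> R by rewrite normrN1.
(* Expand the four inequalities bilinearly. Adding the two with equal signs, or the two with
   opposite signs, cancels the mixed covariances and bounds plus or minus [cov P \1_A \1_B] by
   [- cov P F G]. *)
have := key _ _ n1 n1; have := key _ _ n1 nN1.
have := key _ _ nN1 n1; have := key _ _ nN1 nN1.
rewrite !e1 !eN1.
do 4 (rewrite covDl//; last by exact: bdd_measurableD).
rewrite !covDr// !covNl// !covNr//.
rewrite -cov_indic//.
have : - cov P F G <= \sum_(j <- t) \sum_(i <- s) `|cov P (X i) (X j)|.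
  rewrite /G cov_sumr//; last exact: bdd_measurable_X.
  rewrite -sumrN; apply: ler_sum => j _.
  rewrite /F cov_suml//; [|exact: bdd_measurable_X|exact: bdd_measurable_X].
  by rewrite -sumrN; apply: ler_sum => i _; rewrite -normrN ler_norm.
by rewrite ler_norml; lra.
Qed.

End process.

(** * Approximate independence and monotone classes *)

Section dependence.
Context d (Om : measurableType d) (R : realType) (P : probability Om R).
Implicit Types A B : set Om.

Definition dependence A B : R := fine (P (A `&` B)) - fine (P A) * fine (P B).

Lemma dependenceC A B : dependence A B = dependence B A.
Proof. by rewrite /dependence setIC mulrC. Qed.

Lemma dependence_setC A B : measurable A -> measurable B ->
  dependence A (~` B) = - dependence A B.
Proof.
move=> mA mB; have fin C : measurable C -> P C \is a fin_num by exact: fin_num_measure.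
have -> : dependence A (~` B) =
    (fine (P A) - fine (P (A `&` B))) - fine (P A) * (1 - fine (P B)).
  rewrite /dependence -setDE measureD//; last by rewrite ltey_eq fin.
  rewrite probability_setC// !fineB ?fin//; exact: measurableI.
by rewrite /dependence; ring.
Qed.

(** Continuity of [P] from below, along [F n] and along its trace on [A], carries the closed
    condition to the limit. *)
Lemma dependence_le_ndseq_closed A (e : R) : measurable A ->
  ndseq_closed [set B | measurable B /\ `|dependence A B| <= e].
Proof.
move=> mA F ndF Fe.
have mF n : measurable (F n) by case: (Fe n).
have mU : measurable (\bigcup_n F n) by exact: bigcupT_measurable.
split => //.
have fin C : measurable C -> P C \is a fin_num by exact: fin_num_measure.
have cvgF : fine (P (F n)) @[n --> \oo] --> fine (P (\bigcup_n F n)).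
  by apply: fine_cvg; rewrite fineK ?fin//; exact: nondecreasing_cvg_mu.
have cvgAF : fine (P (A `&` F n)) @[n --> \oo] --> fine (P (A `&` \bigcup_n F n)).
  apply: fine_cvg; rewrite fineK ?fin//; last exact: measurableI.
  rewrite setI_bigcupr; apply: (nondecreasing_cvg_mu (F := fun n => A `&` F n)).
  - by move=> n; exact: measurableI.
  - by rewrite -setI_bigcupr; exact: measurableI.
  - by move=> m n /ndF /subsetPset mn; apply/subsetPset; exact: setIS.
have : `|dependence A (F n)| @[n --> \oo] --> `|dependence A (\bigcup_n F n)|.
  apply: cvg_norm; apply: cvgB => //; apply: cvgMr => //.
apply: (closed_cvg (fun x => x <= e) (@closed_le _ e)).
by apply: nearW => n; case: (Fe n).
Qed.

(** For [e > 0] errors may add up over disjoint unions, so a pi-lambda argument does not fit. The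
    bound does survive complements and monotone limits, which calls for the monotone class theorem
    on a ring. *)
Lemma dependence_le_g_sigma_algebra A (e : R) (G : set (set Om)) :
  measurable A -> setring G -> G setT ->
  (forall B, G B -> measurable B /\ `|dependence A B| <= e) ->
  forall B, <<s G >> B -> `|dependence A B| <= e.
Proof.
move=> mA rG GT Ge B sB.
have nd := @dependence_le_ndseq_closed A e mA.
pose K := [set B | measurable B /\ `|dependence A B| <= e].
have KC C : K C -> K (~` C).
  case=> mC Ce; split; first exact: measurableC.
  by rewrite dependence_setC// normrN.
have mK : monotone K.
  (* Decreasing intersections reduce to increasing unions by complementation. *)
  split => // F niF KF; rewrite -[\bigcap_i _]setCK setC_bigcap.
  apply: (KC); apply: nd => [m n mn|n]; last exact: (KC _ (KF n)).
  by apply/subsetPset/subsetC/subsetPset/niF.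
suff : K B by case.
apply: (monotone_setring_sub_g_sigma_ring mK rG Ge).
(* The monotone class theorem covers the generated sigma-ring; since it contains [setT], it is a
   sigma-algebra and so contains [<<s G >>]. *)
apply: sB; split; last exact: sub_g_sigma_ring.
have [r0 rD rU] := @smallest_sigma_ring _ G.
split => // C rC; apply: rD => //; exact: sub_g_sigma_ring.
Qed.

End dependence.

(** * Triviality of the tail under uniformly summable covariances *)

Section tail_trivial.
Context d (Om : measurableType d) (R : realType) (P : probability Om R).
Context (S : choiceType) (X : S -> {RV P >-> R}).
Hypothesis X01 : zero_one_valued X.
Hypothesis NA : negatively_associated X.

Definition cylinder (D : set S) : set (set Om) :=
  [set A | exists2 s, (forall i, i \in s -> D i) & determined (state X) s A].

Lemma cylinder_setring D : setring (cylinder D).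
Proof.
have cD A B : cylinder D A -> cylinder D B -> cylinder D (A `\` B).
  move=> [s sD dA] [t tD dB]; exists (s ++ t).
    by move=> i; rewrite mem_cat => /orP[/sD|/tD].
  rewrite setDE; apply: determined_setI.
    by apply: sub_determined dA => i is_; rewrite mem_cat is_.
  apply/determined_setC.
  by apply: sub_determined dB => i it; rewrite mem_cat it orbT.
have cC A : cylinder D A -> cylinder D (~` A).
  by move=> [s sD dA]; exists s => //; exact: determined_setC.
split => //; first by exists [::].
by move=> A B cA cB; rewrite -[_ `|` _]setCK setCU -setDE; apply/cC/cD => //; exact: cC.
Qed.

Lemma cylinder_setT D : cylinder D setT.
Proof. by exists [::]. Qed.

(** As [X i] is the numeral of [state X i], each generating event is determined by the single
    coordinate [i]. *)
Lemma sub_sigma_family_cylinder D : sigma_family X D `<=` <<s cylinder D >>.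
Proof.
apply: smallest_sub; first exact: smallest_sigma_algebra.
move=> _ [i Di [B mB <-]]; apply: sub_sigma_algebra.
exists [:: i] => [j|w w' h]; first by rewrite inE => /eqP ->.
by rewrite setTI /= -(state_nat X01 i w) -(state_nat X01 i w') [state X i w]h// inE.
Qed.

Variable M : R.
Hypothesis summable : forall i t, uniq t -> \sum_(j <- t) `|cov P (X i) (X j)| <= M.

Lemma tail_trivial E : tail_sigma_field X E -> P E = 0%E \/ P E = 1%E.
Proof.
move=> tE.
have sE (L : seq S) : sigma_family X (~` [set` L]) E.
  by apply: (tE [set` L]); exact: finite_seq.
have cyl_indep s A : determined (state X) s A -> dependence P A E = 0.
  move=> dA; have mA := measurable_determined dA.
  apply/eqP; rewrite -normr_le0; apply/ler_addgt0Pr => e e0; rewrite add0r.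
  pose a j := \sum_(i <- s) `|cov P (X i) (X j)|.
  have a0 j : 0 <= a j by exact: sumr_ge0.
  have aM t : uniq t -> \sum_(j <- t) a j <= M *+ size s.
    move=> ut; rewrite /a exchange_big/=; elim: (s) => [|i s' IH].
      by rewrite big_nil.
    by rewrite big_cons mulrS lerD// summable.
  have [L HL] := summable_tail a0 aM e0.
  (* Removing [L] makes the covariance sums at most [e]; removing [s] makes the two coordinate sets
     disjoint, as negative association requires. *)
  have := sub_sigma_family_cylinder (sE (L ++ s)).
  apply: dependence_le_g_sigma_algebra => //.
  - exact: cylinder_setring.
  - exact: cylinder_setT.
  - move=> B [t tLs dB]; split; first exact: measurable_determined dB.
    (* The tail estimate for [a] holds for duplicate-free lists only. *)
    have dB' : determined (state X) (undup t) B.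
      by apply: sub_determined dB => i; rewrite mem_undup.
    apply: le_trans (determined_cov_le X01 NA _ dA dB') (HL _ (undup_uniq t) _).
    + move=> i is_; apply/negP; rewrite mem_undup => /tLs /=.
      by rewrite mem_cat is_ orbT.
    + move=> i; rewrite mem_undup => /tLs /= /negP.
      by rewrite mem_cat negb_or => /andP[].
have scE : <<s cylinder setT >> E.
  apply: sub_sigma_family_cylinder; have := sE [::].
  by rewrite set_nil setC0.
have mE : measurable E.
  apply: scE; split; first exact: sigma_algebra_measurable.
  by move=> A [s _ dA]; exact: measurable_determined dA.
(* The same extension with error 0: [E] is independent of every cylinder event, and itself lies in
   the sigma-field they generate. *)
have : `|dependence P E E| <= 0.
  apply: dependence_le_g_sigma_algebra scE => //.
  - exact: cylinder_setring.
  - exact: cylinder_setT.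
  - move=> A [s _ dA]; split; first exact: measurable_determined dA.
    by rewrite dependenceC (cyl_indep _ _ dA) normr0.
rewrite normr_le0 /dependence setIid => /eqP h.
have finE : P E \is a fin_num by exact: fin_num_measure.
have /eqP : fine (P E) * (1 - fine (P E)) = 0 by rewrite mulrBr mulr1.
rewrite mulf_eq0 => /orP[/eqP p0|].
  by left; rewrite -(fineK finE) p0.
by rewrite subr_eq0 => /eqP p1; right; rewrite -(fineK finE) -p1.
Qed.

End tail_trivial.

(** * Summability of stationary nonpositive covariances *)

Lemma ler_sum_uniq_sub (R : numDomainType) (I : eqType) (a : I -> R) s t :
  (forall i, 0 <= a i) -> uniq s -> uniq t -> {subset s <= t} ->
  \sum_(i <- s) a i <= \sum_(i <- t) a i.
Proof.
move=> a0 us ut st; rewrite [leRHS](bigID (mem s))/=.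
rewrite (perm_big [seq i <- t | i \in s]).
  by rewrite big_filter lerDl sumr_ge0.
apply: uniq_perm; rewrite ?filter_uniq// => i; rewrite mem_filter.
by case: (boolP (i \in s)) => // /st ->.
Qed.

(* Each of the [2 m + 2] rows of the covariance matrix on [[0, 2 m + 2)]
   contains [gamma 1], ..., [gamma m] on one side of the diagonal. *)
Lemma covariance_sum_le (R : realType) (gamma : nat -> R) :
  (forall n, (0 < n)%N -> gamma n <= 0) ->
  (forall n, 0 <= \sum_(i <- iota 0 n) \sum_(j <- iota 0 n) gamma `|i%:Z - j%:Z|%N) ->
  forall m, \sum_(k <- iota 1 m) `|gamma k| <= gamma 0.
Proof.
move=> gneg gpsd m.
set Gm := \sum_(k <- iota 1 m) _.
(* Naming [N] through an equation keeps [iota 0 N] from unfolding. *)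
have [N NE] : exists N, N = m.*2.+2 by exists m.*2.+2.
have rowle i : i \in iota 0 N ->
    \sum_(j <- iota 0 N) gamma `|i%:Z - j%:Z|%N <= gamma 0 - Gm.
  rewrite mem_iota => /andP[_ im].
  rewrite (bigD1_seq i) ?iota_uniq ?mem_iota//=.
  rewrite subrr absz0 lerD2l -big_filter lerNr -sumrN.
  (* Walk right from the lower half and left from the upper half: [m] steps stay inside [iota 0 N].
     The entries not visited are nonpositive off the diagonal, so dropping them only raises the row
     sum. *)
  pose phi k := if (i <= m)%N then (i + k)%N else (i - k)%N.
  have phiK k : k \in iota 1 m -> `|i%:Z - (phi k)%:Z|%N = k.
    by rewrite mem_iota /phi => km; case: ifP => h; lia.
  have -> : Gm = \sum_(j <- [seq phi k | k <- iota 1 m]) `|gamma `|i%:Z - j%:Z|%N|.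
    by rewrite big_map; apply: eq_big_seq => k km; rewrite phiK.
  rewrite (le_trans (ler_sum_uniq_sub (t := [seq j <- iota 0 N | j != i]) _ _ _ _))//.
  - rewrite map_inj_in_uniq ?iota_uniq// => k l km lm h.
    by rewrite -(phiK k km) h phiK.
  - by rewrite filter_uniq ?iota_uniq.
  - move=> _ /mapP[k + ->]; rewrite mem_filter !mem_iota /phi => km.
    by case: ifP => h; lia.
  - rewrite !big_filter; apply: ler_sum => j ji.
    by rewrite ler0_norm// gneg//; lia.
have := gpsd N.
have : \sum_(i <- iota 0 N) \sum_(j <- iota 0 N) gamma `|i%:Z - j%:Z|%N
   <= (gamma 0 - Gm) *+ N.
  have <- : \sum_(i <- iota 0 N) (gamma 0 - Gm) = (gamma 0 - Gm) *+ N.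
    by rewrite big_const_seq count_predT size_iota iter_addr_0.
  by rewrite big_seq [leRHS]big_seq; apply: ler_sum.
move=> h1 h2; have := le_trans h2 h1.
by rewrite NE pmulrn_lge0// subr_ge0.
Qed.

(** The values of [h] on [t] are distinct, so the sum is part of an initial segment of the series.
    The index 0 is counted apart because [M] bounds only sums starting at 1. *)
Lemma sum_inj_le (R : realType) (T : eqType) (a : nat -> R) (M : R)
    (h : T -> nat) (t : seq T) :
  (forall k, 0 <= a k) -> (forall m, \sum_(k <- iota 1 m) a k <= M) ->
  uniq t -> {in t &, injective h} -> \sum_(j <- t) a (h j) <= a 0 + M.
Proof.
move=> a0 aM ut hi; rewrite -(big_map h xpredT a).
pose m := \max_(k <- [seq h j | j <- t]) k.
apply: (@le_trans _ _ (\sum_(k <- iota 0 m.+1) a k)).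
  apply: ler_sum_uniq_sub; rewrite ?map_inj_in_uniq ?iota_uniq// => k kt.
  by rewrite mem_iota/= add0n ltnS /m; apply: (leq_bigmax_seq k).
by rewrite /= big_cons lerD2l.
Qed.

Section stationary.
Context d (Om : measurableType d) (R : realType) (P : probability Om R).
Context (S : choiceType) (X : S -> {RV P >-> R}).
Hypothesis X01 : zero_one_valued X.
Hypothesis NA : negatively_associated X.

(* The index sets [nat] and [int] are treated together through an embedding
   [e] into the integers with a section [o] over the naturals. *)
Lemma stationary_cov_sum_le (e : S -> int) (o : nat -> S) (gamma : nat -> R) :
  injective e -> (forall n, e (o n) = n) ->
  (forall i j, cov P (X i) (X j) = gamma `|e i - e j|%N) ->
  forall i t, uniq t -> \sum_(j <- t) `|cov P (X i) (X j)| <= (`|gamma 0| + gamma 0) *+ 2.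
Proof.
move=> einj eo covE i t ut.
have gneg n : (0 < n)%N -> gamma n <= 0.
  (* A single variable is the occupation number of a one-element list, hence admissible. *)
  move=> n0; have -> : gamma n = cov P (X (o n)) (X (o 0)) by rewrite covE !eo subr0.
  have := @cov_admissible_le0 _ _ _ _ _ _ NA [:: o n] [:: o 0] _ _ _
    (admissible_occupation R _) (admissible_occupation R _).
  rewrite !of_process_occupation// !big_seq1; apply => k; rewrite !inE => /eqP ->.
  by apply/eqP => /(congr1 e); rewrite !eo; lia.
have gpsd n : 0 <= \sum_(i <- iota 0 n) \sum_(j <- iota 0 n) gamma `|i%:Z - j%:Z|%N.
  pose F : Om -> R := \sum_(i <- iota 0 n) (X (o i) : Om -> R).
  have bX k : bdd_measurable (X (o k)) by exact: bdd_measurable_X.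
  have bF : bdd_measurable F by exact: bdd_measurable_sum.
  have := cov_ge0 P bF; rewrite {1}/F cov_suml//.
  under eq_bigr do rewrite /F cov_sumr//.
  by under eq_bigr do under eq_bigr do rewrite covE !eo.
have gsum := covariance_sum_le gneg gpsd.
under eq_bigr do rewrite covE.
(* The distance to [i] is injective on each side of [i] but not globally, whence the factor 2 in the
   bound. *)
rewrite (bigID (fun j => e i <= e j))/= mulr2n.
rewrite -[X in X + _]big_filter -[X in _ + X]big_filter.
apply: lerD; apply: (sum_inj_le (a := fun k => `|gamma k|)) => //;
  rewrite ?filter_uniq// => j k; rewrite !mem_filter => /andP[ij _] /andP[ik _] h;
  by apply: einj; lia.
Qed.

End stationary.

Theorem corollary2p9 (R : realType) (d : measure_display)
    (Om : measurableType d) (P : probability Om R) :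
  (forall X : nat -> {RV P >-> R},
     negatively_associated X -> weakly_stationary X -> zero_one_valued X ->
     forall E : set Om, tail_sigma_field X E -> P E = 0%E \/ P E = 1%E) /\
  (forall X : int -> {RV P >-> R},
     negatively_associated X -> weakly_stationary X -> zero_one_valued X ->
     forall E : set Om, tail_sigma_field X E -> P E = 0%E \/ P E = 1%E).
Proof.
split=> X NA st X01 E.
- apply: (tail_trivial X01 NA); apply: (@stationary_cov_sum_le _ _ _ _ _ _ X01 NA
    Posz id (fun n => cov P (X 0) (X n))) => // [i j []//|i j].
  (* Only forward shifts exist here. By symmetry the smaller index can be taken as the shift,
     carrying the pair [0], [j - i] to [i], [j]; the order also makes the truncated subtraction
     genuine. *)
  wlog ij : i j / (i <= j)%N.
    by move=> H; case/orP: (leq_total i j) => /H //; rewrite covC distnC.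
  have [_ /(_ 0 (j - i)%N)] := st i.
  move=> /(congr1 fine); rewrite !fine_covariance; try exact: bdd_measurable_X.
  have -> : (0 + i)%R = i by rewrite add0r.
  have -> : ((j - i)%N + i)%R = j by exact: subnK.
  by move=> <-; congr (cov P _ (X _)); lia.
- apply: (tail_trivial X01 NA); apply: (@stationary_cov_sum_le _ _ _ _ _ _ X01 NA
    id Posz (fun n => cov P (X 0) (X n%:Z))) => // i j.
  wlog ij : i j / i <= j.
    by move=> H; case/orP: (le_total i j) => /H //; rewrite covC distnC.
  have [_ /(_ 0 (j - i))] := st i.
  move=> /(congr1 fine); rewrite !fine_covariance; try exact: bdd_measurable_X.
  rewrite add0r subrK => <-; congr (cov P _ (X _)); lia.
Qed.
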